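(* Let $L>0$ be a fixed constant. Then there is a constant $c_0>0$ (not depending on $n$) such that for every integer $n\ge1$ the critical radius $\varepsilon_n(\mathcal{P}_0^{W}(L),\mathcal{P}_1^{W}(L,\varepsilon))=\inf\{\varepsilon>0: R_n(\varepsilon)\le\tfrac13\}$ satisfies $$\varepsilon_n(\mathcal{P}_0^{W}(L),\mathcal{P}_1^{W}(L,\varepsilon))\ge\frac{c_0}{n^{1/5}}.$$
   Context: For probability measures $\mu,\nu$ on a Euclidean space and $i\in\{1,2\}$, $W_i(\mu,\nu)=\bigl[\inf_{\gamma}\int\|x-y\|_2^i\,d\gamma(x,y)\bigr]^{1/i}$, the infimum being over all couplings $\gamma$ of $\mu$ and $\nu$. All distributions are laws of $(X,Y,Z)$ supported on $[0,1]^3$; $p_{X,Y|Z=z}$ is the conditional law of $(X,Y)$ given $Z=z$ (a version of the regular conditional distribution is used for which the stated conditions hold), and $p_Z$ is the law of $Z$. $\mathcal{P}_0$ is the set of distributions $q$ with $q_{X,Y|Z=z}=q_{X|Z=z}\times q_{Y|Z=z}$ for all $z$ (i.e. $X$ and $Y$ are conditionally independent given $Z$), and $\mathcal{P}_1$ is the set of distributions for which $X$ and $Y$ are not conditionally independent given $Z$. Define $$\mathcal{P}_0^{W}(L)=\{p\in\mathcal{P}_0: W_1(p_{X,Y|Z=z},p_{X,Y|Z=z'})\le L|z-z'|\ \text{for all } z,z'\in[0,1]\},$$ $$\mathcal{P}_1^{W}(L,\varepsilon)=\Bigl\{p\in\mathcal{P}_1: W_1(p_{X,Y|Z=z},p_{X,Y|Z=z'})\le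 L|z-z'|\ \text{for all } z,z'\in[0,1],\ \inf_{q\in\mathcal{P}_0}\mathbb{E}_Z W_2(p_{X,Y|Z},q_{X,Y|Z})\ge\varepsilon\Bigr\},$$ where $\mathbb{E}_Z$ is the expectation over $Z\sim p_Z$, and the infimum over $q\in\mathcal P_0$ is over measurable families of product conditional laws $z\mapsto q_{X|Z=z}\times q_{Y|Z=z}$, $z\in[0,1]$. The minimax risk of testing is $$R_n(\varepsilon)=\inf_{\psi}\Bigl\{\sup_{p\in\mathcal{P}_0^{W}(L)}\mathbb{E}_p[\psi(\mathcal{D}_n)]+\sup_{p\in\mathcal{P}_1^{W}(L,\varepsilon)}\mathbb{E}_p[1-\psi(\mathcal{D}_n)]\Bigr\},$$ where $\mathcal{D}_n=\{(X_1,Y_1,Z_1),\dots,(X_n,Y_n,Z_n)\}$ is an i.i.d. sample from $p$ (and $\mathbb{E}_p$ the corresponding expectation), and the infimum is over all Borel measurable test functions $\psi$ of $\mathcal{D}_n$ with values in $[0,1]$ (the probability of rejecting the null). A supremum over an empty class is taken to be $0$. *)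

(* Defs.v *)
From HB Require Import structures.
From mathcomp Require Import all_boot all_order all_algebra.
From mathcomp Require Import all_classical all_reals all_analysis.

Set Implicit Arguments.
Unset Strict Implicit.
Unset Printing Implicit Defensive.

Import Order.TTheory GRing.Theory Num.Theory.
Import numFieldNormedType.Exports.

Local Open Scope classical_set_scope.
Local Open Scope ring_scope.

Definition unit_square (R : realType) : set (R * R)%type :=
  `[0, 1]%classic `*` `[0, 1]%classic.
Arguments unit_square R : clear implicits.

(* Points (x, y, z) are encoded as nested pairs ((x, y), z). *)
Definition unit_cube (R : realType) : set (R * R * R)%type :=
  unit_square R `*` `[0, 1]%classic.
Arguments unit_cube R : clear implicits.

(* Explicit, because the library norm on R * R is the maximum norm. *)
Definition eucl_dist (R : realType) (u v : R * R) : R :=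
  Num.sqrt ((u.1 - v.1) ^+ 2 + (u.2 - v.2) ^+ 2).

Definition coupling (R : realType)
    (mu nu : {measure set (R * R)%type -> \bar R}) :
    set (probability ((R * R) * (R * R))%type R) :=
  [set g | forall A : set (R * R)%type, measurable A ->
     pushforward g fst A = mu A /\ pushforward g snd A = nu A].

Definition wasserstein (R : realType) (i : nat)
    (mu nu : {measure set (R * R)%type -> \bar R}) : \bar R :=
  poweR
    (ereal_inf [set (\int[g]_w ((eucl_dist w.1 w.2) ^+ i)%:E)%E
               | g in coupling mu nu])
    (i%:R^-1).

Section snd_mfun.
Context (d1 d2 : measure_display).
Context (T1 : measurableType d1) (T2 : measurableType d2).

Definition snd_mfun : T1 * T2 -> T2 := snd.

HB.instance Definition _ :=
  isMeasurableFun.Build _ _ (T1 * T2)%type T2 snd_mfun measurable_snd.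

End snd_mfun.

Definition law_Z (R : realType) (p : probability (R * R * R)%type R) :
    probability R R :=
  distribution p (@snd_mfun _ _ (R * R)%type R).

Definition supported_on_square (R : realType) (k : R.-pker R ~> (R * R)%type) :=
  forall z : R, z \in `[0, 1] -> k z (unit_square R) = 1%E.

(* [k] is a version of the conditional law of (X, Y) given Z; the values of
   [k] off [0, 1] are irrelevant since Z lies in [0, 1] almost surely. *)
Definition cond_law (R : realType) (p : probability (R * R * R)%type R)
    (k : R.-pker R ~> (R * R)%type) :=
  supported_on_square k /\
  forall (A : set (R * R)%type) (B : set R), measurable A -> measurable B ->
    p (A `*` B) = (\int[law_Z p]_(z in B) k z A)%E.

(* The factors [muX] and [muY] are necessarily the marginals of [mu]. *)
Definition product_law (R : realType)
    (mu : {measure set (R * R)%type -> \bar R}) :=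
  exists muX muY : probability R R,
    forall A, measurable A -> mu A = (muX \x muY)%E A.

Definition product_family (R : realType) : set (R.-pker R ~> (R * R)%type) :=
  [set k | supported_on_square k /\
           forall z : R, z \in `[0, 1] -> product_law (k z)].
Arguments product_family R : clear implicits.

Definition laws (R : realType) : set (probability (R * R * R)%type R) :=
  [set p | p (unit_cube R) = 1%E].
Arguments laws R : clear implicits.

Definition P0 (R : realType) : set (probability (R * R * R)%type R) :=
  [set p | laws R p /\ exists2 k, cond_law p k & product_family R k].
Arguments P0 R : clear implicits.

Definition P1 (R : realType) : set (probability (R * R * R)%type R) :=
  [set p | laws R p /\ ~ P0 R p].
Arguments P1 R : clear implicits.

Definition W1_Lipschitz (R : realType) (L : R)
    (k : R.-pker R ~> (R * R)%type) :=
  forall z z' : R, z \in `[0, 1] -> z' \in `[0, 1] ->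
    (wasserstein 1 (k z) (k z') <= (L * `|z - z'|)%:E)%E.

Definition dist_to_P0 (R : realType) (p : probability (R * R * R)%type R)
    (k : R.-pker R ~> (R * R)%type) : \bar R :=
  ereal_inf [set (\int[law_Z p]_(z in `[0%R, 1%R]) wasserstein 2 (k z) (q z))%E
            | q in product_family R].

(* Within each class all conditions are imposed on one and the same version
   of the conditional law. *)
Definition P0W (R : realType) (L : R) :
    set (probability (R * R * R)%type R) :=
  [set p | P0 R p /\ exists k,
     [/\ cond_law p k, product_family R k & W1_Lipschitz L k]].

Definition P1W (R : realType) (L eps : R) :
    set (probability (R * R * R)%type R) :=
  [set p | P1 R p /\ exists k,
     [/\ cond_law p k, W1_Lipschitz L k & (eps%:E <= dist_to_P0 p k)%E]].

Section iid_sample.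
Context (d : measure_display) (T : measurableType d) (R : realType).

Fixpoint sample_display (n : nat) : measure_display :=
  if n is m.+1 then measure_prod_display (d, sample_display m)
  else default_measure_display.

(* The measurable space T * (T * ... (T * unit)) of n-tuples. *)
Fixpoint sample (n : nat) : measurableType (sample_display n) :=
  match n with
  | 0 => unit
  | m.+1 => (T * sample m)%type
  end.

(* The n-fold product of [p]: the law of an i.i.d. sample of size n. *)
Fixpoint iid (p : probability T R) (n : nat) : probability (sample n) R :=
  match n return probability (sample n) R with
  | 0 => dirac tt
  | m.+1 => (p \x iid p m)%E
  end.

End iid_sample.

Definition data (R : realType) (n : nat) := sample (R * R * R)%type n.

Definition tests (R : realType) (n : nat) : set (data R n -> R) :=
  [set psi : data R n -> R |
     measurable_fun setT psi /\ forall D : data R n, 0 <= psi D <= 1].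
Arguments tests R : clear implicits.

(* Supremum of a set of nonnegative values, equal to 0 on the empty set
   (whereas [ereal_sup set0 = -oo]). *)
Definition sup0 (R : realType) (A : set (\bar R)) : \bar R :=
  ereal_sup (0%E |` A).

Definition risk (R : realType) (L : R) (n : nat) (eps : R) : \bar R :=
  ereal_inf [set
    (sup0 [set 'E_(iid p n)[psi] | p in P0W L] +
     sup0 [set 'E_(iid p n)[fun D => (1 - psi D)%R] | p in P1W L eps])%E
    | psi in tests R n].

Definition critical_radius (R : realType) (L : R) (n : nat) : \bar R :=
  ereal_inf [set eps%:E | eps in
    [set eps : R | 0 < eps /\ (risk L n eps <= (3%:R^-1)%:E)%E]].

(* Main.v *)
Require Import Defs.
From HB Require Import structures.
From mathcomp Require Import all_boot all_order all_algebra.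
From mathcomp Require Import all_classical all_reals all_analysis.
From mathcomp Require Import measurable_realfun simple_functions.
From mathcomp Require Import ring lra.

(** Why the bound holds.

The perturbation is bought at the price of a small [W_1] distance and pays off
in a large [W_2] distance: moving a mass [t] over a distance of order 1 costs
[t] in [W_1] but [sqrt t] in [W_2].

Put [(X, Y)] on the four corners of the unit square, with uniform marginals and
correlation [t]; call this law [bits t].  For [t = 0] it is a product law.  Then
- [W_1 (bits t, bits t') <= |t - t'| / 2], because resampling only [Y] turns one
  law into the other ([wasserstein1_bits]);
- every product law on the plane is at [W_2] distance at least [sqrt (|t| / 48)]
  from [bits t] ([wasserstein2_bits_ge]).  A coupling of [bits t] with a product
  law must, with probability at least [|t| / 12], move a corner across one of
  the lines [x = 1/2], [y = 1/2], for otherwise the events [X > 1/2], [Y > 1/2]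
  would keep their covariance [t / 4] while being independent.

Let [Z] be uniform on [m] equally spaced points of the unit interval.  Under
the null the correlation is 0 everywhere; under the alternative it is
[delta * eta_j] at the [j]-th point, for a vector of signs [eta], and it is
interpolated between the points by a Lipschitz extension with constant
[2 * delta * m] ([mcshane]).  Thus the conditional laws are [L]-Lipschitz in
[W_1] as soon as [delta * m <= L], and the distance to conditional
independence is at least [sqrt (delta / 48)] ([grid_law_P1W]).

A test cannot tell the null from the uniform mixture of the [2 ^ m]
alternatives when the chi-square divergence of the mixture from the null is
small ([two_point_le_chi2]).  The second moment of the likelihood ratio of the
mixture is the average over two independent sign vectors of
[(1 + delta ^ 2 / m * sum_j eta_j eta'_j) ^ n], which is at most
[cosh (s) ^ m] with [s = n * delta ^ 2 / m], hence at most [16 / 15] when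
[m * s ^ 2 <= 1 / 16] ([sum_mix_ratio2_le], [risk_ge_half]).

With [delta = c / m] one has [m * s ^ 2 = c ^ 4 * n ^ 2 / m ^ 5], so [m] of order
[n ^ (2/5)] is allowed, and the separation is then of order
[sqrt (1 / m)], that is [n ^ (-1/5)]. *)

Set Implicit Arguments.
Unset Strict Implicit.
Unset Printing Implicit Defensive.

Import Order.TTheory GRing.Theory Num.Theory.
Import numFieldNormedType.Exports.

Local Open Scope classical_set_scope.
Local Open Scope ring_scope.

(** * Finitely supported probability measures *)

Definition is_pmf {R : realType} {I : finType} (w : I -> R) :=
  [forall i, 0 <= w i] && (\sum_i w i == 1).

Lemma is_pmfP (R : realType) (I : finType) (w : I -> R) :
  (forall i, 0 <= w i) -> \sum_i w i = 1 -> is_pmf w.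
Proof. by move=> w0 w1; apply/andP; split; [exact/forallP|exact/eqP]. Qed.

Lemma pmf_ge0 (R : realType) (I : finType) (w : I -> R) i : is_pmf w -> 0 <= w i.
Proof. by case/andP => /forallP. Qed.

Lemma indic_setX T1 T2 (R : realType) (A : set T1) (B : set T2) x y :
  \1_(A `*` B) (x, y) = \1_A x * \1_B y :> R.
Proof.
rewrite !indicE in_setX; case: (_ \in A); case: (_ \in B);
  by rewrite /= ?mulr1 ?mulr0.
Qed.

Section discrete.
Context d (T : measurableType d) (R : realType) (I : finType).
Implicit Types (w : I -> R) (a : I -> T).

(** The measure with mass [`|w i|] at [a i].  Absolute values make it a measure
    for every [w]; finite sums of measures being indexed by initial segments
    of the naturals, [I] is enumerated. *)
Definition atoms w a : {measure set T -> \bar R} :=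
  msum (fun k => if insub k is Some i then
    mscale (NngNum (normr_ge0 (w (@enum_val I predT i)))) \d_(a (@enum_val I predT i))
    else mzero) #|I|.

Lemma atomsE w a A : atoms w a A = (\sum_i `|w i|%:E * \d_(a i) A)%E.
Proof.
rewrite /atoms /= /msum (reindex (@enum_val I predT)) /=; last first.
  by exists enum_rank => i _; rewrite ?enum_valK ?enum_rankK.
by apply: eq_bigr => i _; rewrite valK.
Qed.

(** A probability for every [w], so that it can be declared as one; the Dirac
    mass is a default for weights that do not form a probability vector. *)
Definition discrete w a : set T -> \bar R :=
  if is_pmf w then atoms w a else \d_point.

Let discrete0 w a : discrete w a set0 = 0%E.
Proof. by rewrite /discrete; case: ifP. Qed.
Let discrete_ge0 w a A : (0 <= discrete w a A)%E.
Proof. by rewrite /discrete; case: ifP. Qed.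
Let discrete_sigma w a : semi_sigma_additive (discrete w a).
Proof. rewrite /discrete; case: ifP => _; exact: measure_semi_sigma_additive. Qed.

HB.instance Definition _ w a := isMeasure.Build _ _ _ (discrete w a)
  (discrete0 w a) (discrete_ge0 w a) (@discrete_sigma w a).

Lemma discreteE w a A : is_pmf w ->
  discrete w a A = (\sum_i w i * \1_A (a i))%:E.
Proof.
move=> pw; rewrite /discrete pw atomsE -sumEFin; apply: eq_bigr => i _.
by case/andP: pw => /forallP/(_ i) w0 _; rewrite ger0_norm// diracE EFinM indicE.
Qed.

Let discrete_setT w a : discrete w a setT = 1%E.
Proof.
rewrite /discrete; case: ifP => [pw|_]; last exact: probability_setT.
have := discreteE a setT pw; rewrite /discrete pw => ->.
case/andP: pw => _ /eqP <-; congr EFin; apply: eq_bigr => i _.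
by rewrite indicT mulr1.
Qed.

HB.instance Definition _ w a :=
  @Measure_isProbability.Build _ _ R (discrete w a) (discrete_setT w a).

Lemma integral_discrete w a D (f : T -> \bar R) : is_pmf w -> measurable D ->
  measurable_fun D f -> (forall x, D x -> 0 <= f x)%E ->
  (\int[discrete w a]_(x in D) f x = \sum_i (w i * \1_D (a i))%:E * f (a i))%E.
Proof.
move=> pw mD mf f0; have -> : (\int[discrete w a]_(x in D) f x =
    \int[atoms w a]_(x in D) f x)%E.
  by apply: eq_measure_integral => A mA _; rewrite /= /discrete pw.
rewrite ge0_integral_measure_sum// (reindex (@enum_val I predT)) /=; last first.
  by exists enum_rank => i _; rewrite ?enum_valK ?enum_rankK.
apply: eq_bigr => i _; rewrite valK ge0_integral_mscale//= integral_dirac//.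
case/andP: pw => /forallP/(_ (@enum_val I predT i)) w0 _.
by rewrite ger0_norm// muleA diracE EFinM indicE.
Qed.

End discrete.

(** * Lower bounds for integrals *)

Section lower_bound.
Import HBNNSimple.

(** Markov's inequality.  The integral of a nonnegative function, measurable or
    not, is a supremum over the simple functions below it, and [c] times the
    indicator of [S] is one of them.  The function in view is
    [z |-> W_2 (k z, q z)], whose measurability is unclear. *)
Lemma mul_measure_le_integral d (T : measurableType d) (R : realType)
    (mu : {measure set T -> \bar R}) (D S : set T) (c : R) (f : T -> \bar R) :
  measurable S -> 0 <= c -> (forall x, D x -> 0 <= f x)%E ->
  S `<=` D -> (forall x, S x -> c%:E <= f x)%E ->
  (c%:E * mu S <= \int[mu]_(x in D) f x)%E.
Proof.
move=> mS c0 f0 SD cf.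
pose h : {nnsfun T >-> R} := scale_nnsfun (indic_nnsfun R mS) c0.
have -> : (c%:E * mu S)%E = sintegral mu h.
  rewrite -integralT_nnsfun /=.
  under eq_integral do rewrite EFinM.
  rewrite ge0_integralZl//=; last 2 first.
  - by apply/measurable_EFinP; exact: measurable_indic.
  - by move=> x _; rewrite lee_fin.
  by rewrite integral_indic ?setIT.
rewrite ge0_integralE//; apply: ereal_sup_ubound; exists h => // x /=.
rewrite [mindic _ _ _]indicE /patch; have [xS|xS] := boolP (x \in S).
  by move: xS; rewrite inE => xS; rewrite mulr1 mem_set ?cf//; exact: SD.
by rewrite mulr0; case: ifPn => // /set_mem /f0.
Qed.

End lower_bound.

(** * Samples of a finitely supported law *)

(** Index sequences of samples, nested like [sample] so that statements about
    both are proved by the same induction. *)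
Fixpoint words (I : finType) (n : nat) : finType :=
  if n is m.+1 then (I * words I m)%type else unit.

Fixpoint wprod (R : realType) (I : finType) (w : I -> R) n : words I n -> R :=
  match n with
  | 0 => fun=> 1
  | m.+1 => fun u => w u.1 * wprod w u.2
  end.

Fixpoint points d (T : measurableType d) (I : finType) (a : I -> T) n :
    words I n -> sample T n :=
  match n with
  | 0 => fun=> tt
  | m.+1 => fun u => (a u.1, points a u.2)
  end.

Section words.
Variables (R : realType) (I : finType).
Implicit Types w v : I -> R.

Lemma sum_wprod w n : \sum_(u : words I n) wprod w u = (\sum_i w i) ^+ n.
Proof.
elim: n => [|n IH]; first by rewrite (big_pred1 tt) => [|[]].
rewrite exprS -IH big_distrl /=.
rewrite -(pair_big xpredT xpredT (fun i u => w i * wprod w u)) /=.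
by apply: eq_bigr => i _; rewrite big_distrr.
Qed.

Lemma wprodM w v n (u : words I n) :
  wprod (fun i => w i * v i) u = wprod w u * wprod v u.
Proof.
elim: n u => [|n IH] u /=; first by rewrite mulr1.
by rewrite IH mulrACA.
Qed.

Lemma wprod_ge0 w n (u : words I n) : (forall i, 0 <= w i) -> 0 <= wprod w u.
Proof. by move=> w0; elim: n u => [|n IH] u //=; rewrite mulr_ge0. Qed.

(** The law of a sample of a discrete law is discrete, with the products of the
    weights; this turns error probabilities of tests into finite sums. *)
Lemma integral_iid_discrete d (T : measurableType d) w (a : I -> T) n
    (f : sample T n -> R) : is_pmf w -> measurable_fun setT f ->
  (forall D, 0 <= f D) ->
  (\int[iid (discrete w a) n]_D (f D)%:E =
     (\sum_(u : words I n) wprod w u * f (points a u))%:E)%E.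
Proof.
move=> pw; elim: n f => [|n IH] f mf f0 /=.
  rewrite integral_dirac ?diracT ?mul1e//.
  by rewrite (big_pred1 tt) => [|[]//]; rewrite mul1r.
rewrite fubini_tonelli1//=; last exact/measurable_EFinP.
rewrite /fubini_F /=.
under eq_integral => x _.
  rewrite IH//; last exact: measurableT_comp.
  over.
rewrite integral_discrete//; last 2 first.
- apply: measurableT_comp => //; apply: measurable_sum => u.
  apply: measurable_funM => //; apply: (measurableT_comp mf); exact: measurable_pair2.
- move=> x _; rewrite lee_fin; apply: sumr_ge0 => u _.
  by rewrite mulr_ge0// wprod_ge0//; case/andP: pw => /forallP.
rewrite -(pair_big xpredT xpredT
  (fun i u => w i * wprod w u * f (a i, points a u))) /=.
rewrite -sumEFin; apply: eq_bigr => i _.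
rewrite indicT mulr1 -EFinM; congr EFin; rewrite big_distrr.
by apply: eq_bigr => u _ /=; rewrite mulrA.
Qed.

End words.

(** * Correlated bits *)

Lemma sum_bool2 (R : realType) (F : bool * bool -> R) :
  \sum_i F i = F (true, true) + F (true, false) +
               (F (false, true) + F (false, false)).
Proof.
rewrite (eq_bigr (fun i => F (i.1, i.2))); last by case.
by rewrite -(pair_big xpredT xpredT (fun x y => F (x, y)))/= !big_bool.
Qed.

Lemma sum_pair_bool (R : realType) (I : finType) (F : I * bool -> R) :
  \sum_i F i = \sum_i (F (i, true) + F (i, false)).
Proof.
rewrite (eq_bigr (fun i => F (i.1, i.2))); last by case.
rewrite -(pair_big xpredT xpredT (fun i y => F (i, y)))/=.
by apply: eq_bigr => i _; rewrite big_bool.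
Qed.

Section bits.
Variable R : realType.
Implicit Types t : R.

Definition spin (b : bool) : R := if b then 1 else -1.

Definition bits_pmf t (i : bool * bool) : R := (1 + spin (i.1 == i.2) * t) / 4.

Definition corner (i : bool * bool) : R * R := (i.1%:R, i.2%:R).

Definition bits t : probability (R * R)%type R :=
  discrete (bits_pmf t) corner.

Lemma bits_pmfP t : `|t| <= 1 -> is_pmf (bits_pmf t).
Proof.
rewrite ler_norml => /andP[t1 t2]; apply: is_pmfP => [[x y]|].
  by rewrite /bits_pmf /spin/=; case: eqP => _; lra.
by rewrite sum_bool2 /bits_pmf /spin/=; lra.
Qed.

(** Index [((x, y), y')] stands for moving the corner [(x, y)] to [(x, y')].  As
    much mass as possible stays; the rest, of total mass [`|t - t'| / 2],
    flips its second coordinate. *)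
Definition bits_coupling_pmf t t' (i : bool * bool * bool) : R :=
  let: (x, y, y') := i in
  if y == y' then
    (if x == y then 1 + Num.min t t' else 1 - Num.max t t') / 4
  else (if x == y then t - Num.min t t' else t' - Num.min t t') / 4.

Lemma bits_coupling_pmfP t t' : `|t| <= 1 -> `|t'| <= 1 ->
  is_pmf (bits_coupling_pmf t t').
Proof.
rewrite !ler_norml => /andP[t1 t2] /andP[t1' t2']; apply: is_pmfP.
  move=> [[x y] y']; rewrite /bits_coupling_pmf.
  by case: ifP => _; case: ifP => _; have [?|?] := leP t t'; lra.
rewrite sum_pair_bool sum_bool2 /bits_coupling_pmf /=.
by have := addr_max_min t t'; lra.
Qed.

Lemma measurable_eucl_dist : measurable_fun setT
  (fun w : (R * R) * (R * R) => eucl_dist w.1 w.2).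
Proof.
apply: measurableT_comp.
  apply: continuous_measurable_fun; exact: sqrt_continuous.
have m1 : measurable_fun setT (fun w : (R * R) * (R * R) => w.1.1).
  exact: measurableT_comp.
have m2 : measurable_fun setT (fun w : (R * R) * (R * R) => w.1.2).
  exact: measurableT_comp.
have m3 : measurable_fun setT (fun w : (R * R) * (R * R) => w.2.1).
  exact: measurableT_comp.
have m4 : measurable_fun setT (fun w : (R * R) * (R * R) => w.2.2).
  exact: measurableT_comp.
by apply: measurable_funD; apply: measurable_funX; exact: measurable_funB.
Qed.

(** The coupling moves mass [`|t - t'| / 2] along an edge of the square, of
    length 1. *)
Lemma wasserstein1_bits t t' : `|t| <= 1 -> `|t'| <= 1 ->
  (wasserstein 1 (bits t) (bits t') <= (`|t - t'| / 2)%:E)%E.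
Proof.
move=> t1 t1'; have gP := bits_coupling_pmfP t1 t1'.
rewrite /wasserstein invr1 poweRe1; last first.
  apply: le_ereal_inf_tmp => _ [g _ <-]; apply: integral_ge0 => w _.
  by rewrite lee_fin sqrtr_ge0.
pose g := discrete (bits_coupling_pmf t t')
  (fun i => (corner i.1, corner (i.1.1, i.2))).
apply: ereal_inf_lbound; exists g.
  move=> A mA; rewrite /pushforward /g /bits.
  have Emax : Num.max t t' = t + t' - Num.min t t'.
    by have := addr_max_min t t'; lra.
  have indic_pre (f : (R * R) * (R * R) -> R * R) w :
    \1_(f @^-1` A) w = \1_A (f w) :> R by [].
  split; rewrite /= !discreteE ?bits_pmfP//; congr EFin;
    rewrite sum_pair_bool !sum_bool2 /bits_coupling_pmf /bits_pmf /spin/=;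
    rewrite !indic_pre/= Emax; ring.
rewrite integral_discrete//; last 2 first.
- by apply/measurable_EFinP; exact: measurable_eucl_dist.
- by move=> w _; rewrite lee_fin sqrtr_ge0.
rewrite sumEFin; congr EFin.
rewrite sum_pair_bool !sum_bool2 /bits_coupling_pmf /eucl_dist !indicT/=.
rewrite ?(subrr,subr0,sub0r,sqrrN,expr0n,expr1n,addr0,add0r,sqrtr0,sqrtr1,mulr0,mulr1)/=.
have [h|h] := leP t t'; [rewrite ler0_norm|rewrite gtr0_norm]; lra.
Qed.

(** Independence of the two coordinates, with the marginals expressed through
    [nu] itself. *)
Lemma product_law_rect (nu : {measure set (R * R)%type -> \bar R}) (A B : set R) :
  product_law nu -> measurable A -> measurable B ->
  nu (A `*` B) = (nu (A `*` setT) * nu (setT `*` B))%E.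
Proof.
move=> [muX [muY E]] mA mB; rewrite !E; do ?exact: measurableX.
rewrite !product_measure1E//.
have mul1s (x y u v : \bar R) : u = 1%E -> v = 1%E ->
  (x * y = x * u * (v * y))%E by move=> -> ->; rewrite mule1 mul1e.
by apply: mul1s; exact: probability_setT.
Qed.

Definition upper_half : set R := `]2^-1, +oo[%classic.

Lemma measurable_upper_half : measurable upper_half.
Proof. exact: measurable_itv. Qed.

Lemma upper_halfE x : (x \in upper_half) = (2^-1 < x).
Proof.
by apply/idP/idP; rewrite inE /upper_half/= in_itv/= andbT.
Qed.

Lemma nat_upper_half (b : bool) : (b%:R \in upper_half) = b.
Proof. by rewrite upper_halfE; case: b => /=; lra. Qed.

Lemma bits_upper_half t : `|t| <= 1 ->
  [/\ bits t (upper_half `*` upper_half) = ((1 + t) / 4)%:E,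
      bits t (upper_half `*` setT) = (1 / 2)%:E &
      bits t (setT `*` upper_half) = (1 / 2)%:E].
Proof.
move=> t1; split; rewrite /bits/= discreteE ?bits_pmfP//; congr EFin;
  rewrite sum_bool2 !indic_setX !indicE ?in_setT !nat_upper_half /bits_pmf/spin/=; lra.
Qed.

(** Here [a], [b], [c] are the probabilities of two independent events and of
    their intersection under a law that differs by at most [s] on these events
    from [bits t], for which they are [1 / 2], [1 / 2], [(1 + t) / 4].  Then
    [c - 1 / 4 = (b - 1 / 2) * a + (a - 1 / 2) / 2] is of order [s]. *)
Lemma covariance_gap (a b c s t : R) : 0 <= a <= 1 -> 0 <= s -> c = a * b ->
  `|a - 1 / 2| <= s -> `|b - 1 / 2| <= s -> `|c - (1 + t) / 4| <= s ->
  `|t| <= 12 * s.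
Proof.
move=> /andP[a0 a1] s0 ->; rewrite !ler_norml => /andP[? ?] /andP[? ?] /andP[? ?].
by apply/andP; split; nra.
Qed.

Lemma near_corner (i : bool * bool) (v : R * R) :
  eucl_dist (corner i) v ^+ 2 < 4^-1 ->
  (v.1 \in upper_half) = i.1 /\ (v.2 \in upper_half) = i.2.
Proof.
rewrite /eucl_dist sqr_sqrtr ?addr_ge0 ?sqr_ge0//=; case: i => x y /= h.
have near (b : bool) (r : R) : (b%:R - r) ^+ 2 < 4^-1 -> (r \in upper_half) = b.
  by rewrite upper_halfE; case: b => /= rb; [apply/idP|apply/negbTE; rewrite -leNgt]; nra.
have := sqr_ge0 (x%:R - v.1); have := sqr_ge0 (y%:R - v.2).
by split; apply: near; lra.
Qed.

(** If [mu] lives on [C], and [g]-almost surely outside [S] the two points of the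
    coupling agree on membership in [E], then the probabilities of [E] under
    the marginals differ by at most the mass of [S]. *)
Lemma coupling_diff (mu nu : {measure set (R * R)%type -> \bar R})
    (g : probability ((R * R) * (R * R))%type R) (E C : set (R * R))
    (S : set ((R * R) * (R * R))) :
  coupling mu nu g -> measurable E -> measurable C -> measurable S ->
  mu (~` C) = 0%E ->
  (forall u v, C u -> ~ S (u, v) -> E u <-> E v) ->
  `|fine (nu E) - fine (mu E)| <= fine (g S).
Proof.
move=> gc mE mC mS mu0 h.
have [gE1 gE2] := gc _ mE; have [gC _] := gc _ (measurableC mC).
rewrite /pushforward in gE1 gE2 gC.
have mf (F : set (R * R)) : measurable F ->
  measurable ((fst : (R * R) * (R * R) -> R * R) @^-1` F).
  by move=> mF; rewrite -[X in measurable X]setTI; exact: measurable_fst.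
have ms (F : set (R * R)) : measurable F ->
  measurable ((snd : (R * R) * (R * R) -> R * R) @^-1` F).
  by move=> mF; rewrite -[X in measurable X]setTI; exact: measurable_snd.
(* The comparison is between preimages under either projection, so it is
   stated for arbitrary events of the product space. *)
have three (A B : set ((R * R) * (R * R))) : measurable A -> measurable B ->
    A `<=` B `|` S `|` fst @^-1` (~` C) -> (g A <= g B + g S)%E.
  move=> mA mB AB.
  have mN := mf _ (measurableC mC).
  apply: le_trans (le_measure _ _ _ AB) _; rewrite ?inE//.
    by do 2?apply: measurableU.
  apply: le_trans (measureU2 _ _ _) _ => //; first exact: measurableU.
  by rewrite [X in (_ + X)%E]gC mu0 adde0; exact: measureU2.
have le1 : (mu E <= nu E + g S)%E.
  rewrite -gE1 -gE2; apply: three; [exact: mf|exact: ms|].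
  move=> [u v] /= Eu; have [Cu|] := pselect (C u); last by right.
  by left; have [?|nS] := pselect (S (u, v)); [right|left; apply/(h u v)].
have le2 : (nu E <= mu E + g S)%E.
  rewrite -gE1 -gE2; apply: three; [exact: ms|exact: mf|].
  move=> [u v] /= Eu; have [Cu|] := pselect (C u); last by right.
  by left; have [?|nS] := pselect (S (u, v)); [right|left; apply/(h u v)].
have f1 : nu E \is a fin_num.
  by rewrite -gE2 fin_num_measure//; exact: ms.
have f2 : mu E \is a fin_num.
  by rewrite -gE1 fin_num_measure//; exact: mf.
have f3 : g S \is a fin_num by exact: fin_num_measure.
move: le1 le2; rewrite -(fineK f1) -(fineK f2) -(fineK f3) -!EFinD !lee_fin.
by rewrite ler_norml => ? ?; apply/andP; split; lra.
Qed.

Lemma bits_range t : `|t| <= 1 -> bits t (~` range corner) = 0%E.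
Proof.
move=> t1; rewrite /bits/= discreteE ?bits_pmfP// big1// => i _.
by rewrite indicE in_setC mem_set ?mulr0//=; exists i.
Qed.

Lemma measurable_range_corner : measurable (range corner).
Proof.
have -> : range corner = [set 0; 1] `*` [set 0; 1].
  apply/seteqP; split => [_ [[x y] _ <-]|[x y] [/= hx hy]].
    by split; [case: x|case: y]; rewrite /=; [right|left|right|left].
  by case: hx => ->; case: hy => ->; [exists (false, false)|
    exists (false, true)|exists (true, false)|exists (true, true)].
by apply: measurableX; apply: measurableU; exact: measurable_set1.
Qed.

(** Let [S] be the event that the coupling moves a point by at least [1 / 2].
    Outside [S] a corner stays on its side of both lines [x = 1 / 2] and
    [y = 1 / 2], so [coupling_diff] and [covariance_gap] give
    [g S >= `|t| / 12], and each point of [S] costs at least [1 / 4]. *)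
Lemma wasserstein2_bits_ge t (nu : {measure set (R * R)%type -> \bar R}) :
  `|t| <= 1 -> product_law nu ->
  (((`|t| / 48) `^ 2^-1)%:E <= wasserstein 2 (bits t) nu)%E.
Proof.
move=> t1 nuP; have [hAB hA hB] := bits_upper_half t1.
have infP c : (forall g, coupling (bits t) nu g ->
    (c%:E <= \int[g]_w (eucl_dist w.1 w.2 ^+ 2)%:E)%E) ->
    (c%:E <= ereal_inf [set (\int[g]_w ((eucl_dist w.1 w.2) ^+ 2)%:E)%E
               | g in coupling (bits t) nu])%E.
  by move=> h; apply: le_ereal_inf_tmp => _ [g gc <-]; exact: h.
rewrite /wasserstein -poweR_EFin; apply: gt0_ler_poweR.
- by rewrite invr_ge0.
- by rewrite in_itv/= lee_fin divr_ge0// leey.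
- rewrite in_itv/= leey andbT; apply: infP => g _.
  by apply: integral_ge0 => w _; rewrite lee_fin sqr_ge0.
apply: infP => g gc.
pose S := [set w : (R * R) * (R * R) | 4^-1 <= eucl_dist w.1 w.2 ^+ 2].
have mS : measurable S.
  have -> : S = (fun w => eucl_dist w.1 w.2 ^+ 2) @^-1` `[4^-1, +oo[%classic.
    by apply/seteqP; split => w; rewrite /S/= in_itv/= andbT.
  rewrite -[X in measurable X]setTI; apply: measurable_funX => //.
  exact: measurable_eucl_dist.
have mH := measurable_upper_half.
apply: (@le_trans _ _ (4^-1%:E * g S)%E); last first.
  by apply: mul_measure_le_integral => // w _; rewrite lee_fin sqr_ge0.
have /fineK <- : g S \is a fin_num by exact: fin_num_measure.
have gap (A B : set R) : measurable A -> measurable B ->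
    (forall i v, ~ S (corner i, v) ->
      (A i.1%:R <-> A v.1) /\ (B i.2%:R <-> B v.2)) ->
    `|fine (nu (A `*` B)) - fine (bits t (A `*` B))| <= fine (g S).
  move=> mA mB h; apply: (coupling_diff gc _ measurable_range_corner mS).
  - exact: measurableX.
  - exact: bits_range.
  - move=> _ v [i _ <-] /(h i v) [hA' hB'].
    by split=> -[? ?]; split; apply/hA' || apply/hB'.
have side i v : ~ S (corner i, v) ->
    (upper_half i.1%:R <-> upper_half v.1) /\
    (upper_half i.2%:R <-> upper_half v.2).
  move=> /negP; rewrite -ltNge => /near_corner[h1 h2].
  have iff_half (b : bool) r : (r \in upper_half) = b ->
      (upper_half b%:R <-> upper_half r).
    move=> e; have {}e : (b%:R \in upper_half) = (r \in upper_half).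
      by rewrite nat_upper_half.
    by split=> /mem_set h; apply: set_mem; move: h; rewrite e.
  by split; exact: iff_half.
have gAB := gap _ _ mH mH side.
have gA := gap _ _ mH measurableT (fun i v h => conj (side i v h).1 (iff_refl _)).
have gB := gap _ _ measurableT mH (fun i v h => conj (iff_refl _) (side i v h).2).
rewrite hAB/= in gAB; rewrite hA/= in gA; rewrite hB/= in gB.
have nuE A : measurable A -> nu A = g (snd @^-1` A).
  by move=> /gc[_ <-].
have nu_fin A : measurable A -> nu A \is a fin_num.
  move=> mA; rewrite nuE// fin_num_measure//.
  by rewrite -[X in measurable X]setTI; exact: measurable_snd.
rewrite -EFinM lee_fin -[leRHS]mulrC ler_pdivlMr//.
suff : `|t| <= 12 * fine (g S) by lra.
apply: (covariance_gap _ _ _ gA gB gAB).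
- have mHT : measurable (upper_half `*` [set: R]) by exact: measurableX.
  rewrite fine_ge0//= -lee_fin fineK ?nu_fin// nuE// probability_le1//.
  by rewrite -[X in measurable X]setTI; exact: measurable_snd.
- by rewrite fine_ge0.
- by rewrite product_law_rect// fineM// nu_fin//; exact: measurableX.
Qed.

End bits.

(** * Lipschitz interpolation of prescribed correlations *)

Section mcshane.
Variables (R : realType) (I : finType) (node theta : I -> R) (delta K : R).
Hypothesis K0 : 0 <= K.

(** McShane extension of [theta], the largest [K]-Lipschitz function below
    [theta i] at [node i] for all [i] and below [delta] everywhere; the cap
    [delta] keeps the values in the range of correlations. *)
Definition mcshane (z : R) : R :=
  \big[Num.min/delta]_i (theta i + K * `|z - node i|).

Lemma mcshane_norm z :
  0 <= delta -> (forall i, `|theta i| <= delta) -> `|mcshane z| <= delta.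
Proof.
move=> d0 th; rewrite ler_norml /mcshane bigmin_le_id andbT.
apply: le_bigmin; first lra.
move=> i _; have := th i; rewrite ler_norml => /andP[h _].
by rewrite (le_trans h)// lerDl mulr_ge0.
Qed.

Lemma mcshane_lipschitz z z' : `|mcshane z - mcshane z'| <= K * `|z - z'|.
Proof.
have half x y : mcshane x <= mcshane y + K * `|x - y|.
  rewrite -lerBlDr; apply: le_bigmin => [|i _].
    rewrite lerBlDr (le_trans (bigmin_le_id _ _ _ _))// lerDl mulr_ge0//.
  rewrite lerBlDr -addrA -mulrDr (le_trans (bigmin_le _ i _))//.
  rewrite lerD2l ler_wpM2l//.
  by rewrite (_ : x - node i = (y - node i) + (x - y)) ?ler_normD//; ring.
rewrite ler_norml; have := half z z'; have := half z' z.
by rewrite (distrC z' z) => ? ?; apply/andP; split; lra.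
Qed.

(** Interpolation is exact as soon as the slope [K] is large enough to descend
    from [delta] to [- delta] between two nodes. *)
Lemma mcshane_node i : (forall j, `|theta j| <= delta) ->
  (forall j, j != i -> 2 * delta <= K * `|node i - node j|) ->
  mcshane (node i) = theta i.
Proof.
move=> th sep; apply/eqP; rewrite eq_le; apply/andP; split.
  by rewrite (le_trans (bigmin_le _ i _))// subrr normr0 mulr0 addr0.
apply: le_bigmin => [|j _]; first by rewrite (le_trans (ler_norm _)).
have [->|/sep] := eqVneq j i; first by rewrite subrr normr0 mulr0 addr0.
have := th j; have := th i; rewrite !ler_norml => /andP[? ?] /andP[? ?]; lra.
Qed.

Lemma measurable_mcshane : measurable_fun setT mcshane.
Proof.
have K1 : 0 < K + 1 by rewrite ltr_wpDl.
apply: continuous_measurable_fun => x.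
apply/cvgrPdist_le => e e0; near=> y.
apply: le_trans (mcshane_lipschitz x y) _.
apply: (@le_trans _ _ ((K + 1) * `|x - y|)); first by rewrite ler_wpM2r// lerDl.
rewrite -ler_pdivlMl//.
near: y; apply/nbhs_normP; exists ((K + 1)^-1 * e) => /=.
  by rewrite mulr_gt0// invr_gt0.
by move=> y /ltW.
Unshelve. all: end_near. Qed.

End mcshane.

(** * Laws with a uniform grid of values of Z *)

Section bits_kernel.
Variables (R : realType) (t : R -> R).

(** The hypotheses are arguments because the kernel structure rests on them. *)
Definition bits_kernel of measurable_fun setT t & (forall z, `|t z| <= 1) :
    R -> {measure set (R * R)%type -> \bar R} := fun z => bits (t z).

Hypotheses (mt : measurable_fun setT t) (t1 : forall z, `|t z| <= 1).

Let measurable_bits_kernel U : measurable U ->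
  measurable_fun [set: R] ((bits_kernel mt t1) ^~ U).
Proof.
move=> mU.
rewrite (_ : (fun _ => _) =
  EFin \o (fun z => \sum_i bits_pmf (t z) i * \1_U (corner R i))); last first.
  by apply/funext => z; rewrite /bits_kernel /bits /= discreteE ?bits_pmfP.
apply/measurable_EFinP; apply: measurable_sum => i.
apply: measurable_funM => //; apply: measurable_funM => //.
by apply: measurable_funD => //; exact: measurable_funM.
Qed.

HB.instance Definition _ := isKernel.Build _ _ _ _ _ (bits_kernel mt t1)
  measurable_bits_kernel.

Let bits_kernel_prob x : bits_kernel mt t1 x [set: R * R] = 1%E.
Proof. exact: probability_setT. Qed.

HB.instance Definition _ := Kernel_isProbability.Build _ _ _ _ _
  (bits_kernel mt t1) bits_kernel_prob.

End bits_kernel.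

Lemma product_law_bits0 (R : realType) : product_law (bits (0 : R)).
Proof.
pose c : probability R R := discrete (fun _ : bool => 2^-1) (fun b => b%:R : R).
have c_pmf : is_pmf (fun _ : bool => 2^-1 : R).
  by apply: is_pmfP => [_|]; rewrite ?invr_ge0 ?big_bool//=; lra.
exists c, c => A mA; symmetry; apply: product_measure_unique => // {mA}A B mA mB.
rewrite /bits/= !discreteE ?bits_pmfP ?normr0//; rewrite -EFinM; congr EFin.
by rewrite sum_bool2 !big_bool !indic_setX /bits_pmf/spin/=; field.
Qed.

Section grid.
Variables (R : realType) (m : nat).
Hypothesis m0 : (0 < m)%N.

Definition node (j : 'I_m) : R := j%:R / m%:R.

Let mR0 : 0 < m%:R :> R. Proof. by rewrite ltr0n. Qed.

Lemma node_in01 j : node j \in `[0, 1].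
Proof.
by rewrite in_itv/= divr_ge0//= ler_pdivrMr// mul1r ler_nat ltnW.
Qed.

(** Distinct multiples of [1 / m] are at distance at least [1 / m]; with slope
    [2 * delta * m] this is what [mcshane_node] asks for. *)
Lemma node_sep i j : j != i -> m%:R^-1 <= `|node i - node j|.
Proof.
move=> ji; rewrite /node -mulrBl normrM (gtr0_norm (x := _^-1)) ?invr_gt0//.
rewrite ler_peMl ?invr_ge0 ?ler0n//.
wlog ij : i j ji / (j < i)%N.
  move=> H; have [/H|h|/ord_inj/eqP] := ltngtP j i; first exact.
  - by rewrite distrC; apply: H; rewrite // eq_sym.
  - by rewrite (negbTE ji).
by rewrite -natrB ?(ltnW ij)// normr_nat ler1n subn_gt0.
Qed.

Definition grid_pmf (theta : 'I_m -> R) (u : 'I_m * (bool * bool)) : R :=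
  m%:R^-1 * bits_pmf (theta u.1) u.2.

Definition grid_point (u : 'I_m * (bool * bool)) : R * R * R :=
  (corner R u.2, node u.1).

Definition grid_law theta : probability (R * R * R)%type R :=
  discrete (grid_pmf theta) grid_point.

Lemma sum_grid theta (F : 'I_m -> bool * bool -> R) :
  \sum_u grid_pmf theta u * F u.1 u.2 =
  \sum_j m%:R^-1 * \sum_i bits_pmf (theta j) i * F j i.
Proof.
under [RHS]eq_bigr do rewrite big_distrr.
rewrite pair_big/=; apply: eq_bigr => -[j i] _; rewrite /grid_pmf/=.
exact: esym (mulrA _ _ _).
Qed.

Lemma sum_uniform : \sum_(j < m) m%:R^-1 = 1 :> R.
Proof. by rewrite sumr_const card_ord -[LHS]mulr_natl mulfV// gt_eqF. Qed.

Lemma uniform_pmfP : is_pmf (fun _ : 'I_m => m%:R^-1 : R).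
Proof. by apply: is_pmfP => [_|]; rewrite ?invr_ge0 ?ler0n ?sum_uniform. Qed.

Variable theta : 'I_m -> R.
Hypothesis theta1 : forall j, `|theta j| <= 1.

Let bits1 j : \sum_i bits_pmf (theta j) i = 1.
Proof. by have /andP[_ /eqP] := bits_pmfP (theta1 j). Qed.

Lemma grid_pmfP : is_pmf (grid_pmf theta).
Proof.
apply: is_pmfP => [[j i]|].
  by rewrite mulr_ge0 ?invr_ge0 ?(pmf_ge0 _ (bits_pmfP _)).
under eq_bigr do rewrite -[grid_pmf _ _]mulr1.
rewrite (sum_grid theta (fun _ _ => 1)) -[RHS]sum_uniform.
apply: eq_bigr => j _; under eq_bigr do rewrite mulr1.
by rewrite bits1 mulr1.
Qed.

(** Fubini for the grid: draw the node uniformly, then the corner. *)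
Lemma grid_law_rect A B : grid_law theta (A `*` B) =
  (\sum_j m%:R^-1 * \1_B (node j) * \sum_i bits_pmf (theta j) i * \1_A (corner R i))%:E.
Proof.
rewrite /grid_law/= discreteE ?grid_pmfP//; congr EFin.
under [LHS]eq_bigr do rewrite indic_setX.
rewrite (sum_grid theta (fun j i => \1_A (corner R i) * \1_B (node j))).
apply: eq_bigr => j _; rewrite -mulrA; congr (_ * _).
by rewrite big_distrr; apply: eq_bigr => i _; rewrite /=; ring.
Qed.

Lemma law_Z_grid B : law_Z (grid_law theta) B = discrete (fun _ : 'I_m => m%:R^-1) node B.
Proof.
rewrite /law_Z /distribution /pushforward /=.
have -> : (snd_mfun (T1 := (R * R)%type) (T2 := R)) @^-1` B = setT `*` B.
  by apply/seteqP; split => [[u z]|[u z] []]//=.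
rewrite grid_law_rect discreteE ?uniform_pmfP//; congr EFin.
apply: eq_bigr => j _; rewrite -[RHS]mulr1; congr (_ * _).
by rewrite -[RHS](bits1 j); apply: eq_bigr => i _; rewrite indicT mulr1.
Qed.

Lemma integral_law_Z_grid B (f : R -> \bar R) : measurable B ->
  measurable_fun setT f -> (forall z, 0 <= f z)%E ->
  (\int[law_Z (grid_law theta)]_(z in B) f z =
   \sum_j (m%:R^-1 * \1_B (node j))%:E * f (node j))%E.
Proof.
move=> mB mf f0.
rewrite (eq_measure_integral (discrete (fun _ : 'I_m => m%:R^-1) node)).
  by rewrite integral_discrete ?uniform_pmfP//; exact: measurable_funTS.
by move=> A mA _; exact: law_Z_grid.
Qed.

Lemma grid_law_cube : laws R (grid_law theta).
Proof.
rewrite /laws/= grid_law_rect; congr EFin; rewrite -[RHS]sum_uniform.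
apply: eq_bigr => j _; rewrite indicE mem_set; last exact: node_in01.
rewrite mulr1 -[RHS]mulr1; congr (_ * _); rewrite -[RHS](bits1 j).
apply: eq_bigr => -[x y] _; rewrite indicE mem_set ?mulr1//.
by split; rewrite /= in_itv/=; [case: x|case: y]; rewrite /= lexx ler01.
Qed.

Variable t : R -> R.
Hypotheses (mt : measurable_fun setT t) (t1 : forall z, `|t z| <= 1).
Hypothesis t_node : forall j, t (node j) = theta j.

(** [Z] takes its values in the nodes, so any function [t] that interpolates
    [theta] yields a version of the conditional law. *)
Lemma cond_law_grid : cond_law (grid_law theta) (bits_kernel mt t1).
Proof.
split.
  move=> z _; rewrite /bits_kernel /bits/= discreteE ?bits_pmfP//; congr EFin.
  have /andP[_ /eqP <-] := bits_pmfP (t1 z).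
  apply: eq_bigr => -[x y] _; rewrite indicE mem_set ?mulr1//.
  by split; rewrite /= in_itv/=; [case: x|case: y]; rewrite /= lexx ler01.
move=> A B mA mB; rewrite integral_law_Z_grid//; last exact: measurable_kernel.
rewrite grid_law_rect -sumEFin; apply: eq_bigr => j _.
rewrite EFinM; congr (_ * _)%E.
by rewrite /bits_kernel /bits/= discreteE ?bits_pmfP// t_node.
Qed.

End grid.

(** * Membership in the null and alternative classes *)

Section hypotheses.
Variables (R : realType) (L : R) (m : nat).
Hypotheses (L0 : 0 < L) (m0 : (0 < m)%N).

(** The constant kernel [bits 0] is a product law and trivially Lipschitz. *)
Lemma null_P0W : P0W L (grid_law (fun _ : 'I_m => 0)).
Proof.
have n0 (z : R) : `|0 : R| <= 1 by rewrite normr0.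
have mc : measurable_fun [set: R] (fun _ : R => 0 : R) by exact: measurable_cst.
pose k := bits_kernel mc n0.
have ck : cond_law (grid_law (fun _ : 'I_m => 0)) k.
  by apply: cond_law_grid => // j; rewrite normr0.
have pk : product_family R k.
  split; first by case: ck.
  by move=> z _; exact: product_law_bits0.
split.
  split; first by apply: grid_law_cube => // j; rewrite normr0.
  by exists k.
exists k; split => // z z' _ _.
apply: le_trans (wasserstein1_bits _ _) _; rewrite ?normr0//.
by rewrite lee_fin subrr normr0 mul0r mulr_ge0// ltW.
Qed.

Variables (delta : R) (theta : 'I_m -> R).
Hypotheses (delta0 : 0 < delta) (delta1 : delta <= 1) (deltaL : delta * m%:R <= L).
Hypothesis theta_norm : forall j, `|theta j| = delta.

Let theta1 j : `|theta j| <= 1. Proof. by rewrite theta_norm. Qed.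

Let K := 2 * delta * m%:R.

Let K0 : 0 <= K. Proof. by rewrite /K !mulr_ge0// ltW. Qed.

Let t := mcshane (@node R m) theta delta K.

Let mt : measurable_fun setT t. Proof. exact: measurable_mcshane. Qed.

Let t_norm z : `|t z| <= delta.
Proof. by apply: mcshane_norm => // [|j]; rewrite ?theta_norm// ltW. Qed.

Let t1 z : `|t z| <= 1. Proof. exact: le_trans delta1. Qed.

Let t_node j : t (node R j) = theta j.
Proof.
apply: mcshane_node => [i|i ij]; first by rewrite theta_norm.
rewrite /K -[leRHS]mulrA ler_peMr ?mulr_ge0 ?(ltW delta0)//.
by rewrite -ler_pdivrMl ?ltr0n// mulr1 node_sep// eq_sym.
Qed.

Lemma law_Z_full B : (forall j : 'I_m, B (node R j)) ->
  law_Z (grid_law theta) B = 1%E.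
Proof.
move=> BN; rewrite law_Z_grid// discreteE ?uniform_pmfP//.
congr EFin; rewrite -[RHS](sum_uniform R m0); apply: eq_bigr => j _.
by rewrite indicE mem_set ?mulr1//; exact: BN.
Qed.

(** At every node the conditional law is at [W_2] distance at least
    [sqrt (delta / 48)] from every product law, and [Z] is almost surely a
    node.  The nodes are caught in the measurable set where
    [`|t z| >= delta]. *)
Lemma grid_law_dist : (((delta / 48) `^ 2^-1)%:E <=
  dist_to_P0 (grid_law theta) (bits_kernel mt t1))%E.
Proof.
apply: le_ereal_inf_tmp => _ [q [_ qP] <-].
(* Defined through [t] rather than as the set of nodes: measurability then
   comes from that of [t]. *)
pose S := `[0, 1]%classic `&` [set z | delta <= `|t z|].
have mS : measurable S.
  apply: measurableI => //.
  have -> : [set z | delta <= `|t z|] = (fun z => `|t z|) @^-1` `[delta, +oo[%classic.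
    by apply/seteqP; split => z; rewrite /= in_itv/= andbT.
  by rewrite -[X in measurable X]setTI; apply: measurableT_comp.
rewrite -[leLHS]mule1 -(@law_Z_full S); last first.
  move=> j; split; first exact: node_in01.
  by rewrite /= t_node theta_norm.
apply: mul_measure_le_integral => //.
- exact: powR_ge0.
- by move=> z _; exact: poweR_ge0.
- by move=> z [].
- move=> z [z01 tz]; apply: le_trans (wasserstein2_bits_ge (t1 z) (qP z z01)).
  rewrite lee_fin ge0_ler_powR ?nnegrE ?divr_ge0 ?invr_ge0 ?(ltW delta0)//.
  by rewrite ler_wpM2r// invr_ge0.
Qed.

(** A node has positive probability, so all versions of the conditional law
    agree there; but [bits (theta j)] is not a product law. *)
Lemma grid_law_notP0 : ~ P0 R (grid_law theta).
Proof.
move=> [_ [k ck [_ pk]]].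
pose j0 := Ordinal m0; pose z0 := node R j0.
have z01 : z0 \in `[0, 1] by exact: node_in01.
have ck' := cond_law_grid m0 theta1 mt t1 t_node.
have mz : measurable [set z0] by exact: measurable_set1.
have massE (k' : R.-pker R ~> (R * R)%type) A :
  cond_law (grid_law theta) k' -> measurable A ->
  grid_law theta (A `*` [set z0]) = (k' z0 A * law_Z (grid_law theta) [set z0])%E.
  move=> [_ E] mA; rewrite E// (eq_integral (cst (k' z0 A))).
    by rewrite integral_cst.
  by move=> z; rewrite inE => ->.
have lz : law_Z (grid_law theta) [set z0] = (m%:R^-1)%:E.
  rewrite law_Z_grid// discreteE ?uniform_pmfP//; congr EFin.
  rewrite (bigD1 j0)//= indicE mem_set// mulr1 big1 ?addr0// => j jj0.
  rewrite indicE memNset ?mulr0// => zz.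
  have := node_sep R m0 jj0; rewrite -/z0 zz subrr normr0.
  by rewrite leNgt invr_gt0 ltr0n m0.
have kE A : measurable A -> k z0 A = bits (theta j0) A.
  move=> mA; have := massE _ _ ck mA; rewrite (massE _ _ ck' mA) lz.
  have -> : bits_kernel mt t1 z0 A = bits (theta j0) A by rewrite -t_node.
  have /fineK <- : k z0 A \is a fin_num by exact: kernel_finite_transition.
  have /fineK <- : bits (theta j0) A \is a fin_num by exact: fin_num_measure.
  rewrite -!EFinM => -[] /mulIf -> //.
  by rewrite invr_eq0 pnatr_eq0 -lt0n.
have [hAB hA hB] := bits_upper_half (theta1 j0).
have mU := @measurable_upper_half R.
have := product_law_rect (pk _ z01) mU mU.
rewrite !kE; do ?exact: measurableX.
rewrite hAB hA hB -EFinM => -[] h.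
have : theta j0 = 0 by lra.
by move=> th; have := theta_norm j0; rewrite th normr0 => d0;
  move: delta0; rewrite -d0 ltxx.
Qed.

Lemma grid_law_P1W eps : eps <= (delta / 48) `^ 2^-1 -> P1W L eps (grid_law theta).
Proof.
move=> he; split.
  by split; [exact: grid_law_cube|exact: grid_law_notP0].
exists (bits_kernel mt t1); split.
- exact: cond_law_grid.
- move=> z z' _ _; apply: le_trans (wasserstein1_bits _ _) _ => //.
  rewrite lee_fin ler_pdivrMr//.
  apply: le_trans (mcshane_lipschitz _ _ _ K0 _ _) _.
  by rewrite [leRHS]mulrAC ler_wpM2r// /K -mulrA mulrC ler_wpM2r.
- by apply: le_trans grid_law_dist; rewrite lee_fin.
Qed.

End hypotheses.

(** * The chi-square bound for the mixture of alternatives *)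

(** Le Cam's two-point bound: [l] is the likelihood ratio of the alternative
    with respect to [P], and the sum of squares on the left is 1 plus the
    chi-square divergence.  Pointwise, with [x = l - 1] and [y = 1 - psi],
    [psi + l * (1 - psi) = 1 + x * y >= 1 - x ^+ 2 - y ^+ 2 / 4]. *)
Lemma two_point_le_chi2 (R : realType) (W : finType) (P l psi : W -> R) :
  (forall u, 0 <= P u) -> \sum_u P u = 1 -> \sum_u P u * l u = 1 ->
  (forall u, 0 <= psi u <= 1) ->
  7 / 4 - \sum_u P u * l u ^+ 2 <=
    \sum_u P u * psi u + \sum_u P u * l u * (1 - psi u).
Proof.
move=> P0 P1 Pl psi01.
have -> : 7 / 4 - \sum_u P u * l u ^+ 2 =
    \sum_u P u * (3 / 4 - (l u - 1) ^+ 2) :> R.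
  transitivity (- 4^-1 * \sum_u P u + 2 * (\sum_u P u * l u) - \sum_u P u * l u ^+ 2).
    by rewrite P1 Pl; lra.
  rewrite !big_distrr -sumrN -!big_split /=; apply: eq_bigr => u _; lra.
rewrite -big_split; apply: ler_sum => u _ /=.
rewrite -mulrA -mulrDr ler_wpM2l//; have /andP[? ?] := psi01 u.
by have := sqr_ge0 (l u - 1 + (1 - psi u) / 2); nra.
Qed.

(** Apply [expR (- x) >= 1 - x] to [s] and to [- s], and average the
    reciprocals. *)
Lemma expR_cosh_le (R : realType) (s : R) : s ^+ 2 < 1 ->
  (expR s + expR (- s)) / 2 <= (1 - s ^+ 2)^-1.
Proof.
move=> s1.
have s2 : 0 < 1 - s /\ 0 < 1 + s by split; nra.
have inv_le (x : R) : 0 < 1 - x -> expR x <= (1 - x)^-1.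
  move=> x1; rewrite -[x in expR x]opprK expRN lef_pV2 ?posrE ?expR_gt0//.
  exact: expR_ge1Dx.
have h1 := inv_le s s2.1.
have h2 : expR (- s) <= (1 + s)^-1.
  by have := inv_le (- s); rewrite opprK; apply; exact: s2.2.
rewrite (_ : (1 - s ^+ 2)^-1 = ((1 - s)^-1 + (1 + s)^-1) / 2); first lra.
by field; rewrite !gt_eqF ?s2.1 ?s2.2//; lra.
Qed.

Lemma bernoulli_ineq (R : realType) (x : R) n : 0 <= x <= 1 ->
  1 - n%:R * x <= (1 - x) ^+ n.
Proof.
move=> /andP[x0 x1]; elim: n => [|n IH]; first by rewrite mul0r subr0.
rewrite exprS; apply: le_trans (_ : (1 - x) * (1 - n%:R * x) <= _); last first.
  by rewrite ler_wpM2l// subr_ge0.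
rewrite -natr1; have : 0 <= n%:R * (x * x) by rewrite mulr_ge0// mulr_ge0.
by nra.
Qed.

Section mixture.
Variables (R : realType) (m n : nat) (delta : R).
Hypothesis m0 : (0 < m)%N.
Hypotheses (delta0 : 0 <= delta) (delta1 : delta <= 1).

Let signs := {ffun 'I_m -> bool}.
Let idx := ('I_m * (bool * bool))%type.

Definition signed (eta : signs) (j : 'I_m) : R := delta * spin R (eta j).

(** Likelihood ratio of one observation under the signs [eta], relative to the
    law with independent bits. *)
Definition ratio (eta : signs) (u : idx) : R :=
  1 + signed eta u.1 * spin R (u.2.1 == u.2.2).

Let p0 : idx -> R := grid_pmf (fun=> 0).

Lemma grid_pmf_signed eta u : grid_pmf (signed eta) u = p0 u * ratio eta u.
Proof. by rewrite /p0 /grid_pmf /bits_pmf /ratio; field; rewrite pnatr_eq0 -lt0n. Qed.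

(** The linear terms vanish since the product of the two centred bits has mean
    zero under the null. *)
Lemma sum_ratio2 eta eta' :
  \sum_u p0 u * (ratio eta u * ratio eta' u) =
  1 + delta ^+ 2 / m%:R * \sum_j spin R (eta j) * spin R (eta' j).
Proof.
rewrite (sum_grid (fun=> 0) (fun j i => ratio eta (j, i) * ratio eta' (j, i))).
transitivity (\sum_(j < m) (m%:R^-1 +
    delta ^+ 2 / m%:R * (spin R (eta j) * spin R (eta' j)))); last first.
  by rewrite big_split/= sum_uniform// -mulr_sumr.
apply: eq_bigr => j _.
rewrite sum_bool2 /bits_pmf /ratio /signed /=.
by rewrite /spin/=; case: (eta j); case: (eta' j); field; rewrite pnatr_eq0 -lt0n.
Qed.

Lemma sum_ratio eta : \sum_u p0 u * ratio eta u = 1.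
Proof.
rewrite (sum_grid (fun=> 0) (fun j i => ratio eta (j, i))).
rewrite -[RHS](sum_uniform R m0); apply: eq_bigr => j _ /=.
rewrite sum_bool2 /bits_pmf /ratio /signed /=.
by rewrite /spin/=; case: (eta j); field; rewrite pnatr_eq0 -lt0n.
Qed.

Let N : R := #|signs|%:R.

Lemma N_def : N = 2 ^+ m.
Proof. by rewrite /N /signs card_ffun card_bool card_ord natrX. Qed.

(** Likelihood ratio of the whole sample for the uniform mixture over the
    signs. *)
Definition mix_ratio (u : words idx n) : R := N^-1 * \sum_eta wprod (ratio eta) u.

Lemma sum_mix_ratio : \sum_u wprod p0 u * mix_ratio u = 1.
Proof.
under eq_bigr do rewrite /mix_ratio mulrCA big_distrr /=.
rewrite -big_distrr exchange_big /=.
under eq_bigr => eta _.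
  under eq_bigr do rewrite -wprodM.
  rewrite sum_wprod sum_ratio expr1n; over.
rewrite sumr_const -[X in _ * X]mulr_natl mulr1 mulVf//.
by rewrite N_def expf_neq0.
Qed.

Let s := n%:R * (delta ^+ 2 / m%:R).

(** Expanding the square gives a double average over sign vectors [eta],
    [eta'] of an [n]-th power of [1 + x], which is at most [expR (n * x)].
    The exponential factors over the grid, and for each fixed [eta] the average
    over [eta'] is [cosh s ^ m] whatever [eta] is. *)
Lemma sum_mix_ratio2_le : s ^+ 2 < 1 ->
  \sum_u wprod p0 u * mix_ratio u ^+ 2 <= (1 - s ^+ 2)^-1 ^+ m.
Proof.
move=> s1.
have -> : \sum_u wprod p0 u * mix_ratio u ^+ 2 =
    N^-1 ^+ 2 * \sum_(eta : signs) \sum_(eta' : signs)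
      (1 + delta ^+ 2 / m%:R * \sum_j spin R (eta j) * spin R (eta' j)) ^+ n.
  under eq_bigr do rewrite /mix_ratio exprMn mulrCA.
  rewrite -big_distrr; congr (_ * _).
  under eq_bigr => u _.
    rewrite expr2 big_distrlr big_distrr /=.
    under eq_bigr do rewrite big_distrr /=.
    over.
  rewrite exchange_big; apply: eq_bigr => eta _.
  rewrite exchange_big; apply: eq_bigr => eta' _.
  under eq_bigr do rewrite -wprodM -wprodM.
  by rewrite sum_wprod sum_ratio2.
have row (eta : signs) : \sum_(eta' : signs)
      (1 + delta ^+ 2 / m%:R * \sum_j spin R (eta j) * spin R (eta' j)) ^+ n
    <= (expR s + expR (- s)) ^+ m.
  have -> : (expR s + expR (- s)) ^+ m =
      \sum_(eta' : signs) \prod_j expR (s * (spin R (eta j) * spin R (eta' j))).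
    rewrite -(bigA_distr_bigA (fun j b => expR (s * (spin R (eta j) * spin R b)))).
    rewrite -[in LHS](card_ord m) -prodr_const; apply: eq_bigr => j _.
    rewrite big_bool /spin; case: (eta j) => /=; rewrite ?mulN1r ?mul1r ?opprK ?mulr1 ?mulrN1//.
    by rewrite addrC.
  apply: ler_sum => eta' _.
  rewrite -expR_sum -mulr_sumr /s -[X in expR X]mulrA expRM_natl.
  (* The base of the [n]-th power must be nonnegative for the power to be
     monotone. *)
  have b1 : -1 <= delta ^+ 2 / m%:R * \sum_j spin R (eta j) * spin R (eta' j).
    have : `|\sum_j spin R (eta j) * spin R (eta' j)| <= m%:R.
      apply: le_trans (ler_norm_sum _ _ _) _.
      rewrite -[in leRHS](card_ord m) -sumr_const; apply: ler_sum => j _.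
      by rewrite /spin; case: (eta j); case: (eta' j);
        rewrite ?mulr1 ?mulrN1 ?opprK ?normrN normr1.
    rewrite ler_norml => /andP[h _].
    rewrite mulrAC ler_pdivlMr ?ltr0n// mulN1r.
    have d2 : 0 <= delta ^+ 2 <= 1 by rewrite sqr_ge0/= expr_le1.
    move: h d2 => h /andP[d20 d21].
    apply: (@le_trans _ _ (delta ^+ 2 * (- m%:R))); last by rewrite ler_wpM2l.
    by rewrite mulrN lerN2 ler_piMl.
  by apply: lerXn2r; rewrite ?nnegrE ?expR_ge0 ?expR_ge1Dx//; lra.
apply: (@le_trans _ _ (N^-1 ^+ 2 * \sum_(eta : signs) (expR s + expR (- s)) ^+ m)).
  by rewrite ler_wpM2l ?exprn_ge0 ?invr_ge0 ?ler0n//; apply: ler_sum.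
rewrite sumr_const -[X in _ * X]mulr_natl -/N N_def expr2 mulrACA.
rewrite mulrA mulVf ?expf_neq0// mul1r -exprVn -exprMn.
apply: lerXn2r; rewrite ?nnegrE ?invr_ge0 ?subr_ge0 ?(ltW s1)//.
by rewrite mulrC; exact: expR_cosh_le.
Qed.

End mixture.

(** * Lower bound on the risk and choice of the grid *)

(** The least [m] with [n ^ 2 <= m ^ 5]: its predecessor violates this
    inequality and, unless [m = 1], is at least [m / 2]. *)
Lemma bin_count (n : nat) : (1 <= n)%N ->
  exists m, [/\ (0 < m)%N, (n ^ 2 <= m ^ 5)%N & (m ^ 5 <= 32 * n ^ 2)%N].
Proof.
move=> n1; have ex : exists m, (n ^ 2 <= m ^ 5)%N.
  by exists n; rewrite leq_pexp2l.
case: (ex_minnP ex) => -[|m] mP min.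
  by move: mP; rewrite exp0n// leqn0 expn_eq0/=; case: n n1 {ex min}.
exists m.+1; split => //.
case: m mP min => [|m] mP min.
  by rewrite exp1n muln_gt0 expn_gt0 n1.
have lt : (m.+1 ^ 5 < n ^ 2)%N.
  by rewrite ltnNge; apply/negP => /min; rewrite ltnn.
apply: (@leq_trans ((2 * m.+1) ^ 5)).
  by rewrite leq_exp2r// mul2n -addnn addSn ltnS leq_addl.
by rewrite expnMn leq_mul2l ltnW ?orbT.
Qed.

Lemma expectation_iid_grid (R : realType) m (m0 : (0 < m)%N) (theta : 'I_m -> R) n
    (f : data R n -> R) : (forall j, `|theta j| <= 1) ->
  measurable_fun setT f -> (forall D, 0 <= f D) ->
  ('E_(iid (grid_law theta) n)[f] =
   (\sum_u wprod (grid_pmf theta) u * f (points (@grid_point R m) u))%:E)%E.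
Proof.
move=> th mf f0; rewrite unlock.
by apply: integral_iid_discrete => //; exact: grid_pmfP.
Qed.

Lemma exists_ge_average (R : realType) (I : finType) (i0 : I) (b : I -> R) :
  exists i, #|I|%:R^-1 * \sum_j b j <= b i.
Proof.
case: (arg_maxP b (i0 := i0) (P := xpredT) isT) => i _ max_i.
exists i; rewrite ler_pdivrMl; last by rewrite ltr0n; apply/card_gt0P; exists i0.
by rewrite mulr_natl -sumr_const; apply: ler_sum => j _; exact: max_i.
Qed.

Lemma inv_pow_le (R : realType) (x : R) m : 0 <= x <= 1 -> m%:R * x <= 16^-1 ->
  (1 - x)^-1 ^+ m <= 16 / 15.
Proof.
move=> x01 mx; have h : 15 / 16 <= (1 - x) ^+ m.
  by apply: le_trans (bernoulli_ineq _ x01); lra.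
rewrite exprVn (_ : 16 / 15 = (15 / 16)^-1 :> R); last by field.
by rewrite lef_pV2// posrE; lra.
Qed.

Lemma half_le_risk (R : realType) (a b c S : R) :
  S <= 16 / 15 -> 7 / 4 - S <= a + c -> c <= b -> 2^-1 <= a + b.
Proof. by move=> ? ? ?; lra. Qed.

Section risk.
Variables (R : realType) (L delta eps : R) (m n : nat).
Hypotheses (L0 : 0 < L) (m0 : (0 < m)%N).
Hypotheses (delta0 : 0 < delta) (delta1 : delta <= 1) (deltaL : delta * m%:R <= L).
Hypothesis heps : eps <= (delta / 48) `^ 2^-1.
Let s := n%:R * (delta ^+ 2 / m%:R).
Hypothesis s16 : m%:R * s ^+ 2 <= 16^-1.

(** Some alternative has a type II error at least equal to that of the mixture,
    so the risk is at least that of testing the null against the mixture. *)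
Lemma risk_ge_half : ((2^-1)%:E <= risk L n eps)%E.
Proof.
have s2 : s ^+ 2 <= 16^-1.
  by apply: le_trans s16; rewrite ler_peMl ?sqr_ge0// ler1n.
have s_lt1 : s ^+ 2 < 1 by lra.
have s01 : 0 <= s ^+ 2 <= 1 by rewrite sqr_ge0 ltW.
apply: le_ereal_inf_tmp => _ [psi [mpsi psi01] <-].
have theta_norm (eta : {ffun 'I_m -> bool}) j : `|signed delta eta j| = delta.
  by rewrite /signed /spin; case: (eta j);
    rewrite ?mulr1 ?mulrN1 ?normrN gtr0_norm.
have theta1 (eta : {ffun 'I_m -> bool}) j : `|signed delta eta j| <= 1 by rewrite theta_norm.
pose P u := wprod (grid_pmf (fun _ : 'I_m => 0 : R)) (n := n) u.
pose f u := psi (points (@grid_point R m) u).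
have f01 u : 0 <= f u <= 1 by exact: psi01.
have zero1 (j : 'I_m) : `|0 : R| <= 1 by rewrite normr0.
have P0 u : 0 <= P u.
  by apply: wprod_ge0 => i; apply: pmf_ge0; exact: grid_pmfP.
have P1 : \sum_u P u = 1.
  rewrite /P sum_wprod; have /andP[_ /eqP ->] := grid_pmfP m0 zero1.
  by rewrite expr1n.
pose b (eta : {ffun 'I_m -> bool}) :=
  \sum_u P u * wprod (ratio delta eta) u * (1 - f u).
have [eta etaP] := exists_ge_average ([ffun=> true] : {ffun 'I_m -> bool}) b.
have typeI : ((\sum_u P u * f u)%:E <=
    Defs.sup0 [set 'E_(iid p n)[psi] | p in P0W L])%E.
  apply: ereal_sup_ubound; right; exists (grid_law (fun _ : 'I_m => 0)).
    exact: null_P0W.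
  by rewrite expectation_iid_grid// => D; have /andP[] := psi01 D.
have typeII : ((b eta)%:E <=
    Defs.sup0 [set 'E_(iid p n)[fun D => (1 - psi D)%R] | p in P1W L eps])%E.
  apply: ereal_sup_ubound; right; exists (grid_law (signed delta eta)).
    exact: (grid_law_P1W m0 delta0).
  rewrite expectation_iid_grid//; last 2 first.
  - exact: measurable_funB.
  - by move=> D; rewrite subr_ge0; have /andP[] := psi01 D.
  congr EFin; apply: eq_bigr => u _; congr (_ * _).
  rewrite /P -wprodM; congr (wprod _ u); apply/funext => i.
  exact: grid_pmf_signed.
apply: le_trans (leeD typeI typeII).
rewrite -EFinD lee_fin.
have := two_point_le_chi2 P0 P1 (sum_mix_ratio n delta m0) f01.
have -> : \sum_u P u * mix_ratio delta u * (1 - f u) =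
    #|{ffun 'I_m -> bool}|%:R^-1 * \sum_eta b eta.
  rewrite /b exchange_big big_distrr; apply: eq_bigr => u _ /=.
  by rewrite /mix_ratio -mulr_suml -mulr_sumr; ring.
move=> le_cam; apply: half_le_risk le_cam etaP.
apply: le_trans (sum_mix_ratio2_le m0 (ltW delta0) delta1 s_lt1) _.
exact: inv_pow_le.
Qed.

End risk.

Theorem theorem3p1 (R : realType) (L : R) (hL : 0 < L) :
  exists c0 : R, 0 < c0 /\
    forall n : nat, (1 <= n)%N ->
      ((c0 / (n%:R `^ (5%:R^-1)))%:E <= critical_radius L n)%E.
Proof.
pose c := Num.min L 2^-1.
have c_gt0 : 0 < c by rewrite lt_min hL invr_gt0 ltr0n.
have cL : c <= L by rewrite ge_min lexx.
have c2 : c <= 2^-1 by rewrite ge_min lexx orbT.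
(* [m <= 2 * n ^ (2/5)] turns [sqrt (c / (48 * m))] into
   [sqrt (c / 96) / n ^ (1/5)]. *)
exists (Num.sqrt (c / 96)); split; first by rewrite sqrtr_gt0 divr_gt0.
move=> n n1; have [m [m0 nm mn]] := bin_count n1.
have mR : 0 < m%:R :> R by rewrite ltr0n.
apply: le_ereal_inf_tmp => _ [eps [eps0 risk_le] <-]; rewrite lee_fin leNgt.
apply/negP => eps_lt; have : ((2^-1 : R)%:E <= (3^-1)%:E)%E.
  apply: le_trans risk_le; apply: (@risk_ge_half _ L (c / m%:R) eps m n) => //.
  - by rewrite divr_gt0.
  - rewrite ler_pdivrMr// mul1r (le_trans c2)// (le_trans (_ : _ <= 1))//; first lra.
    by rewrite ler1n.
  - by rewrite divfK ?gt_eqF.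
  - apply: le_trans (ltW eps_lt) _.
    set r := n%:R `^ _.
    have r0 : 0 < r by rewrite powR_gt0// ltr0n.
    have r5 : r ^+ 5 = n%:R.
      by rewrite -powR_mulrn ?(ltW r0)// -powRrM mulVf ?pnatr_eq0// powRr1.
    have mr : m%:R <= 2 * r ^+ 2.
      rewrite -(@ler_pXn2r _ 5)// ?nnegrE ?mulr_ge0 ?sqr_ge0 ?(ltW mR) ?(ltW r0)//.
      rewrite exprMn -exprM mulnC exprM r5 -!natrX -natrM ler_nat.
      by rewrite (leq_trans mn).
    rewrite powR12_sqrt; last by rewrite !divr_ge0// ltW.
    rewrite -[X in _ / X](ger0_norm (ltW r0)) -sqrtr_sqr -sqrtrV ?sqr_ge0//.
    rewrite -sqrtrM; last by rewrite divr_ge0// ltW.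
    rewrite ler_sqrt; last by rewrite !divr_ge0// ltW.
    rewrite -!mulrA ler_pM2l// -!invfM lef_pV2 ?posrE ?mulr_gt0 ?exprn_gt0//.
    by lra.
  - rewrite (_ : _ * _ ^+ 2 = n%:R ^+ 2 / m%:R ^+ 5 * c ^+ 4); last first.
      by field; rewrite gt_eqF.
    have c4 : c ^+ 4 <= 16^-1.
      apply: le_trans (lerXn2r 4 _ _ c2) _; rewrite ?nnegrE ?(ltW c_gt0)//.
      by rewrite exprVn -natrX.
    have nm1 : n%:R ^+ 2 / m%:R ^+ 5 <= 1 :> R.
      by rewrite ler_pdivrMr ?exprn_gt0// mul1r -!natrX ler_nat.
    apply: le_trans c4; rewrite ler_piMl// exprn_ge0// ltW//.
by rewrite lee_fin; lra.
Qed.
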